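(* Let $K\in\mathbb{N}_0$ and assume $|\mathcal{F}_K|<\infty$. Let $S=(S_t)_{0\le t\le K}$ be a strictly positive adapted process and let $X=(X_k)_{k=0,\ldots,K}$ be a regular consumption process with respect to $S$ such that $0<X_k<A_k$ for $k=0,\ldots,K-1$ and $X_K>0$. Then there exists a positively homogeneous projection property $\psi=(\psi_0,\ldots,\psi_K)$ such that $X$ has the property $\psi$, i.e. $X_k=\psi_k(X_{k+1})$ for $k=0,\ldots,K-1$ and $X_K=\psi_KA_K$. This statement is in general not true for consumption processes that are only regular: there exist a setting with $|\mathcal{F}_K|<\infty$ and a regular consumption process $X$ for which no positively homogeneous projection property $\psi$ exists such that $X$ has the property $\psi$.
   Context: Let $(\Omega,\mathcal{F},\mathbb{P})$ be a probability space with a filtration $(\mathcal{F}_t)_{0\le t\le K}$, $K\in\mathbb{N}_0$. $S=(S_t)_{0\le t\le K}$ is a strictly positive real-valued process adapted to $(\mathcal{F}_t)$ (money account without consumption). A consumption process is a real-valued process $X=(X_k)_{k=0,\ldots,K}$ adapted to $(\mathcal{F}_k)_{k=0,\ldots,K}$. The money account with consumption $A=(A_t)_{0\le t\le K}$ associated with $S$ and $X$ is defined by $A_0=S_0$ and $A_t=(A_k-X_k)S_t/S_k$ for $k<t\le k+1$, $k=0,\ldots,K-1$. $X$ is called regular with respect to $S$ if $0\le X_k\le A_k$ for $k=0,\ldots,K$. Equalities and inequalities between random variables are understood pointwise. $L^0(\mathcal{F}_k)$ denotes the set of real-valued $\mathcal{F}_k$-measurable random variables, and $L^0_+(\mathcal{F}_k)$,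 $L^0_-(\mathcal{F}_k)$ the subsets of non-negative, respectively non-positive, ones. A positively homogeneous projection property (PHPP) is a tuple $\psi=(\psi_0,\ldots,\psi_K)$ such that: for $k=0,\ldots,K-1$, $\psi_k$ is a mapping $L^0(\mathcal{F}_{k+1})\to L^0(\mathcal{F}_k)$ (not necessarily linear) which maps $L^0_+(\mathcal{F}_{k+1})$ into $L^0_+(\mathcal{F}_k)$ and $L^0_-(\mathcal{F}_{k+1})$ into $L^0_-(\mathcal{F}_k)$ and satisfies $\psi_k(YX)=Y\psi_k(X)$ for all $X\in L^0(\mathcal{F}_{k+1})$, $Y\in L^0_+(\mathcal{F}_k)$; and $\psi_K\in L^0_+(\mathcal{F}_K)$ is a random variable with $\psi_K\le 1$. *)

(* Defs.v *)
From HB Require Import structures.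
From mathcomp Require Import all_boot all_order all_algebra.
From mathcomp Require Import all_classical all_reals all_analysis.
Set Implicit Arguments.
Unset Strict Implicit.
Unset Printing Implicit Defensive.
Import Order.TTheory GRing.Theory Num.Theory.
Import numFieldNormedType.Exports.
Local Open Scope classical_set_scope.
Local Open Scope ring_scope.

(* Processes in continuous time on [0, K] are functions R -> T -> R of which
   only the values at times t with 0 <= t <= K%:R are constrained; likewise a
   filtration (F_t)_{0 <= t <= K} is a function R -> set (set T). *)

Record filtration d (T : measurableType d) (R : realType) (K : nat)
    (F : R -> set (set T)) : Prop := Filtration {
  filtration_sigma_algebra : forall t, 0 <= t <= K%:R ->
    sigma_algebra [set: T] (F t);
  filtration_measurable : forall t, 0 <= t <= K%:R ->
    F t `<=` measurable;
  filtration_nondecreasing : forall s t, 0 <= s -> s <= t -> t <= K%:R ->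
    F s `<=` F t }.

(* g_sigma_algebraType G carries the sigma-algebra generated by G, which is G
   itself when G is a sigma-algebra.  Random variables are genuine functions,
   not classes modulo almost sure equality. *)
Definition L0 (T : pointedType) (R : realType) (G : set (set T)) : set (T -> R) :=
  [set f | measurable_fun [set: g_sigma_algebraType G] f].

Definition L0p (T : pointedType) (R : realType) (G : set (set T)) : set (T -> R) :=
  [set f | L0 G f /\ forall w, 0 <= f w].

Definition L0n (T : pointedType) (R : realType) (G : set (set T)) : set (T -> R) :=
  [set f | L0 G f /\ forall w, f w <= 0].

Definition adapted (T : pointedType) (R : realType) (K : nat)
    (F : R -> set (set T)) (S : R -> T -> R) : Prop :=
  forall t, 0 <= t <= K%:R -> L0 (F t) (S t).

Definition strictly_positive (T : Type) (R : realType) (K : nat)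
    (S : R -> T -> R) : Prop :=
  forall t, 0 <= t <= K%:R -> forall w, 0 < S t w.

Definition consumption_process (T : pointedType) (R : realType) (K : nat)
    (F : R -> set (set T)) (X : nat -> T -> R) : Prop :=
  forall k, (k <= K)%N -> L0 (F k%:R) (X k).

Fixpoint money_account_nat (T : Type) (R : realType) (S : R -> T -> R)
    (X : nat -> T -> R) (k : nat) : T -> R :=
  if k is j.+1 then
    fun w => (money_account_nat S X j w - X j w) * S j.+1%:R w / S j%:R w
  else S 0.

(* For 0 < t, the integer k with k < t <= k + 1 is ceil t - 1. *)
Definition money_account (T : Type) (R : realType) (S : R -> T -> R)
    (X : nat -> T -> R) (t : R) : T -> R :=
  if t <= 0 then S 0 else
    let k := `|Num.ceil t|%N.-1 in
    fun w => (money_account_nat S X k w - X k w) * S t w / S k%:R w.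

Lemma money_account0 (T : Type) (R : realType) (S : R -> T -> R)
    (X : nat -> T -> R) : money_account S X 0 = S 0.
Proof. by rewrite /money_account lexx. Qed.

Lemma money_account_natE (T : Type) (R : realType) (S : R -> T -> R)
    (X : nat -> T -> R) (k : nat) :
  money_account S X k%:R = money_account_nat S X k.
Proof.
case: k => [|k]; first exact: money_account0.
by rewrite /money_account lern0 /= (intrKceil k.+1).
Qed.

Lemma money_accountE (T : Type) (R : realType) (S : R -> T -> R)
    (X : nat -> T -> R) (k : nat) (t : R) (w : T) : k%:R < t <= k.+1%:R ->
  money_account S X t w =
    (money_account S X k%:R w - X k w) * S t w / S k%:R w.
Proof.
move=> /andP[kt tk]; rewrite money_account_natE /money_account.
rewrite leNgt (le_lt_trans (ler0n _ k) kt) /=.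
suff -> : Num.ceil t = k.+1%:Z by [].
by apply: ceil_def; rewrite -addn1 PoszD addrK -PoszD addn1 kt tk.
Qed.

Definition regular (T : Type) (R : realType) (K : nat) (S : R -> T -> R)
    (X : nat -> T -> R) : Prop :=
  forall k, (k <= K)%N -> forall w, 0 <= X k w <= money_account S X k%:R w.

(* phpp_map k is psi_k for k < K (its values for k >= K, or outside
   L^0(F_{k+1}), are irrelevant) and phpp_last is the random variable psi_K. *)
Record phpp (T : pointedType) (R : realType) (K : nat)
    (F : R -> set (set T)) := Phpp {
  phpp_map : nat -> (T -> R) -> (T -> R);
  phpp_last : T -> R;
  phpp_map_L0 : forall k, (k < K)%N -> forall Z : T -> R,
    L0 (F k.+1%:R) Z -> L0 (F k%:R) (phpp_map k Z);
  phpp_map_L0p : forall k, (k < K)%N -> forall Z : T -> R,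
    L0p (F k.+1%:R) Z -> L0p (F k%:R) (phpp_map k Z);
  phpp_map_L0n : forall k, (k < K)%N -> forall Z : T -> R,
    L0n (F k.+1%:R) Z -> L0n (F k%:R) (phpp_map k Z);
  phpp_map_homogeneous : forall k, (k < K)%N -> forall Z Y : T -> R,
    L0 (F k.+1%:R) Z -> L0p (F k%:R) Y ->
    phpp_map k (Y \* Z) = Y \* phpp_map k Z;
  phpp_last_L0p : L0p (F K%:R) phpp_last;
  phpp_last_le1 : forall w, phpp_last w <= 1 }.

Definition has_property (T : pointedType) (R : realType) (K : nat)
    (F : R -> set (set T)) (S : R -> T -> R) (X : nat -> T -> R)
    (psi : phpp K F) : Prop :=
  (forall k, (k < K)%N -> X k = phpp_map psi k (X k.+1)) /\
  X K = phpp_last psi \* money_account S X K%:R.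

(* Main.v *)
Require Import Defs.
From HB Require Import structures.
From mathcomp Require Import all_boot all_order all_algebra.
From mathcomp Require Import all_classical all_reals all_analysis.
Set Implicit Arguments.
Unset Strict Implicit.
Unset Printing Implicit Defensive.
Import Order.TTheory GRing.Theory Num.Theory.
Import numFieldNormedType.Exports.
Local Open Scope classical_set_scope.
Local Open Scope ring_scope.

(* A finite sigma-algebra is generated by its atoms, so measurability means
   constancy on atoms.  Choosing a point r(w) in the atom of F_k containing w,
   the linear map psi_k(Z)(w) = X_k(w) Z(r(w)) / X_{k+1}(r(w)) does the job,
   together with psi_K = X_K / A_K.  Conversely homogeneity with Y = 0 forces
   psi_k(0) = 0, so X_k must vanish when X_{k+1} does: X_0 = 1, X_1 = 0 is a
   regular counterexample. *)

Section Atoms.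
Variables (T : pointedType) (R : realType).
Implicit Types (G H : set (set T)) (f : T -> R).

Definition atom G (w : T) : set T := [set v | forall A, G A -> A w -> A v].

(** [get] depends only on the set [atom G w], so all points of one atom share the same
    representative. *)
Definition atom_rep G (w : T) : T := get (atom G w).

Lemma atom_repP G w : atom G w (atom_rep G w).
Proof. by apply: (@getI _ _ w) => A. Qed.

Lemma sub_atom G H w : G `<=` H -> atom H w `<=` atom G w.
Proof. by move=> GH v wv A /GH; exact: wv. Qed.

(** Closure under complements: a member of [G] containing [v] but not [w] would have a complement
    that contains [w], hence also [v]. *)
Lemma atom_sym G w v : sigma_algebra setT G -> atom G w v -> atom G v w.
Proof.
move=> [_ GC _] wv A GA Av; apply: contrapT => nAw.
by have := wv _ (GC _ GA); rewrite setTD => /(_ nAw); apply.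
Qed.

Lemma atom_eq G w v : sigma_algebra setT G -> atom G w v -> atom G w = atom G v.
Proof.
move=> sG wv; have vw := atom_sym sG wv.
by apply/seteqP; split=> u uP A GA; [move/(vw _ GA)|move/(wv _ GA)]; exact: uP.
Qed.

Lemma L0_atom G f w v : sigma_algebra setT G -> L0 G f -> atom G w v ->
  f v = f w.
Proof.
move=> sG Gf wv.
(* The level set of [f] at the value [f w] is a member of [G] containing [w], so it contains the
   whole atom of [w]. *)
have := Gf measurableT _ (measurable_set1 (f w)).
rewrite setTI measurable_g_measurableTypeE// => GA.
exact: (wv _ GA erefl).
Qed.

Lemma measurable_atom G w : sigma_algebra setT G -> finite_set G ->
  measurable (atom G w : set (g_sigma_algebraType G)).
Proof.
move=> sG finG.
(* Finiteness of [G] turns the defining condition of the atom into a finite intersection of members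
   of [G]. *)
have -> : atom G w = \bigcap_(A in G `&` [set A | A w]) A.
  by apply/seteqP; split=> v vP A => [[]|GA Aw]; [exact: vP|exact: vP].
apply: fin_bigcap_measurable => [|A [GA _]]; first exact: finite_setIl.
exact: sub_sigma_algebra.
Qed.

Lemma atom_L0 G f : sigma_algebra setT G -> finite_set G ->
  (forall w v, atom G w v -> f v = f w) -> L0 G f.
Proof.
move=> sG finG fG _ B mB; rewrite setTI.
(* The preimage is a union of atoms. Indexing the union by members of [G] rather than by points of
   [T] makes it finite. *)
have -> : f @^-1` B = \bigcup_(A in G `&` [set A | A `<=` f @^-1` B]) A.
  apply/seteqP; split=> [w Bw|w [A [_ AB] /AB //]].
  exists (atom G w) => //; split.
    by have := measurable_atom w sG finG; rewrite measurable_g_measurableTypeE.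
  by move=> v wv; rewrite /preimage /= (fG _ _ wv).
apply: fin_bigcup_measurable => [|A [GA _]]; first exact: finite_setIl.
exact: sub_sigma_algebra.
Qed.

End Atoms.

Lemma filtration_finite d (T : measurableType d) (R : realType) (K k : nat)
    (F : R -> set (set T)) :
  filtration K F -> finite_set (F K%:R) -> (k <= K)%N -> finite_set (F k%:R).
Proof.
move=> [_ _ F_mono] finF kK; apply: sub_finite_set finF.
by apply: F_mono; rewrite ?ler0n ?ler_nat.
Qed.

Lemma filtration_sigma d (T : measurableType d) (R : realType) (K k : nat)
    (F : R -> set (set T)) :
  filtration K F -> (k <= K)%N -> sigma_algebra setT (F k%:R).
Proof. by move=> [+ _ _] kK; apply; rewrite ler0n ler_nat. Qed.

(** An atom of [F K%:R] lies inside an atom of every earlier [F k%:R]. All [S k%:R] and [X k] are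
    therefore constant on it, and the recursion defining the account preserves this. *)
Lemma money_account_nat_L0 d (T : measurableType d) (R : realType) (K : nat)
    (F : R -> set (set T)) (S : R -> T -> R) (X : nat -> T -> R) :
  filtration K F -> finite_set (F K%:R) -> adapted K F S ->
  consumption_process K F X -> L0 (F K%:R) (money_account_nat S X K).
Proof.
move=> FF finF SF XF; apply: atom_L0 => //; first exact: filtration_sigma FF _.
move=> w v wv.
have atomF k : (k <= K)%N -> atom (F k%:R) w v.
  move=> kK; apply: sub_atom wv.
  by apply: (filtration_nondecreasing FF); rewrite ?ler0n ?ler_nat.
have Sc k : (k <= K)%N -> S k%:R v = S k%:R w.
  move=> kK; apply: L0_atom (atomF _ kK); first exact: filtration_sigma FF _.
  by apply: SF; rewrite ler0n ler_nat.
have Xc k : (k <= K)%N -> X k v = X k w.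
  move=> kK; apply: L0_atom (atomF _ kK); first exact: filtration_sigma FF _.
  exact: XF.
suff Ac k : (k <= K)%N -> money_account_nat S X k v = money_account_nat S X k w.
  exact: Ac.
elim: k => [|k IHk] kK /=; first exact: (Sc 0%N).
by rewrite IHk ?Xc ?Sc // ltnW.
Qed.

Section PositiveConsumption.
Context d (T : measurableType d) (R : realType) (K : nat).
Variables (F : R -> set (set T)) (S : R -> T -> R) (X : nat -> T -> R).
Hypotheses (FF : filtration K F) (finF : finite_set (F K%:R)).
Hypotheses (SF : adapted K F S) (XF : consumption_process K F X).
Hypotheses (Xreg : regular K S X).
Hypothesis (X_gt0 : forall k, (k <= K)%N -> forall w, 0 < X k w).

(** Only [Z / X k.+1] is evaluated at the representative. The factor [X k] is already constant on
    atoms of [F k%:R] and stays at [w], so the ratio cancels to [X k w] when [Z] is [X k.+1]. *)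
Definition rep_map (k : nat) (Z : T -> R) (w : T) : R :=
  X k w * (Z (atom_rep (F k%:R) w) / X k.+1 (atom_rep (F k%:R) w)).

Lemma rep_map_L0 k Z : (k < K)%N -> L0 (F k%:R) (rep_map k Z).
Proof.
move=> kK; have sF := filtration_sigma FF (ltnW kK).
apply: atom_L0 => //; first exact: filtration_finite FF finF (ltnW kK).
move=> w v wv; rewrite /rep_map /atom_rep (atom_eq sF wv).
by rewrite (L0_atom sF (XF (ltnW kK)) wv).
Qed.

Lemma rep_map_L0p k Z : (k < K)%N ->
  L0p (F k.+1%:R) Z -> L0p (F k%:R) (rep_map k Z).
Proof.
move=> kK [_ Z0]; split; first exact: rep_map_L0.
move=> w; apply: mulr_ge0; first exact/ltW/X_gt0/ltnW.
by apply: divr_ge0 => //; exact/ltW/X_gt0.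
Qed.

Lemma rep_map_L0n k Z : (k < K)%N ->
  L0n (F k.+1%:R) Z -> L0n (F k%:R) (rep_map k Z).
Proof.
move=> kK [_ Z0]; split; first exact: rep_map_L0.
move=> w; apply: mulr_ge0_le0; first exact/ltW/X_gt0/ltnW.
by apply: mulr_le0_ge0 => //; rewrite invr_ge0; exact/ltW/X_gt0.
Qed.

(** [Y] takes the same value at [w] and at its representative, so it factors out of the
    evaluation. *)
Lemma rep_map_homogeneous k (Z Y : T -> R) : (k < K)%N ->
  L0p (F k%:R) Y -> rep_map k (Y \* Z) = Y \* rep_map k Z.
Proof.
move=> kK [Y0 _]; apply/funext => w; rewrite /rep_map /=.
rewrite (L0_atom (filtration_sigma FF (ltnW kK)) Y0 (@atom_repP _ _ w)).
by rewrite -!mulrA mulrCA.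
Qed.

Lemma rep_map_consumption k : (k < K)%N -> rep_map k (X k.+1) = X k.
Proof.
by move=> kK; apply/funext => w; rewrite /rep_map divff ?mulr1 // gt_eqF ?X_gt0.
Qed.

Definition last_ratio (w : T) : R := X K w / money_account_nat S X K w.

(** Regularity at the final time bounds the account below by [X K], which is positive; this makes
    [last_ratio] a genuine quotient. *)
Lemma money_account_gt0 w : 0 < money_account_nat S X K w.
Proof.
have /andP[_] := Xreg (leqnn K) w; rewrite money_account_natE.
by apply: lt_le_trans; exact: X_gt0.
Qed.

Lemma last_ratio_L0p : L0p (F K%:R) last_ratio.
Proof.
have sF := filtration_sigma FF (leqnn K).
split; last by move=> w; rewrite divr_ge0 ?ltW ?money_account_gt0 ?X_gt0.
apply: atom_L0 => // w v wv; rewrite /last_ratio.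
by rewrite (L0_atom sF (XF (leqnn K)) wv)
  (L0_atom sF (money_account_nat_L0 FF finF SF XF) wv).
Qed.

Lemma last_ratio_le1 w : last_ratio w <= 1.
Proof.
rewrite ler_pdivrMr ?money_account_gt0 // mul1r -money_account_natE.
by have /andP[] := Xreg (leqnn K) w.
Qed.

Definition rep_phpp : phpp K F :=
  @Phpp T R K F rep_map last_ratio
    (fun k kK Z _ => rep_map_L0 Z kK)
    (fun k kK Z => rep_map_L0p kK)
    (fun k kK Z => rep_map_L0n kK)
    (fun k kK Z Y _ => rep_map_homogeneous Z kK)
    last_ratio_L0p last_ratio_le1.

Lemma rep_phpp_property : has_property S X rep_phpp.
Proof.
split=> [k kK|]; first by rewrite /= rep_map_consumption.
rewrite money_account_natE; apply/funext => w /=.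
by rewrite /last_ratio divfK // gt_eqF ?money_account_gt0.
Qed.

End PositiveConsumption.

Lemma phpp_map0 (T : pointedType) (R : realType) (K k : nat)
    (F : R -> set (set T)) (psi : phpp K F) : (k < K)%N ->
  phpp_map psi k (cst 0) = cst 0.
Proof.
move=> kK; have L0_0 G : L0 G (cst 0 : T -> R) by exact: measurable_cst.
have /= := @phpp_map_homogeneous T R K F psi k kK (cst 0) (cst 0) (L0_0 _).
have -> : (cst 0 : T -> R) \* cst 0 = cst 0.
  by apply/funext => w; rewrite /= mul0r.
by move=> ->; [apply/funext => w; rewrite /= mul0r|split=> //= w].
Qed.

Lemma regular_without_phpp (R : realType) :
  exists (d : measure_display) (T : measurableType d) (P : probability T R)
     (K : nat) (F : R -> set (set T)) (S : R -> T -> R) (X : nat -> T -> R),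
     (filtration K F /\ finite_set (F K%:R)) /\
     (adapted K F S /\ strictly_positive K S) /\
     (consumption_process K F X /\ regular K S X) /\
     ~ exists psi : phpp K F, has_property S X psi.
Proof.
(* One-point space, one period, constant price 1: consuming the whole account at time 0 leaves
   nothing at time 1. *)
pose X k : unit -> R := cst (k == 0%N)%:R.
exists _, unit, (\d_tt : probability unit R), 1%N, (fun=> measurable).
exists (fun=> cst 1), X.
split; [split|split; [split|split; [split|]]].
- by split=> // *; exact: sigma_algebra_measurable.
- apply: (@sub_finite_set _ _ [set set0; setT]) => [A _|].
    exact: set_unit.
  exact: finite_set2.
- by move=> t _; exact: measurable_cst.
- by move=> t _ w /=.
- by move=> k _; exact: measurable_cst.
(* At time 0 the bounds read 0 <= 1 <= 1; at time 1 the account is (1 - 1) * 1 / 1 = 0, as is the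
   consumption. *)
- move=> [|[|//]] _ w; rewrite money_account_natE /= ?lexx ?ler01 //.
  by rewrite subrr mul0r mul0r lexx.
- move=> [psi [/(_ 0%N isT) X0 _]].
  (* Evaluated at the only point, the property at time 0 becomes 1 = 0. *)
  have := congr1 (fun f => f tt) X0.
  rewrite (_ : X 1%N = cst 0) // phpp_map0 //=.
  by move/eqP; rewrite oner_eq0.
Qed.

Theorem proposition1 (R : realType) :
  (forall (d : measure_display) (T : measurableType d) (P : probability T R)
     (K : nat) (F : R -> set (set T)) (S : R -> T -> R) (X : nat -> T -> R),
     filtration K F -> finite_set (F K%:R) ->
     adapted K F S -> strictly_positive K S ->
     consumption_process K F X -> regular K S X ->
     (forall k, (k < K)%N ->
        forall w, 0 < X k w < money_account S X k%:R w) ->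
     (forall w, 0 < X K w) ->
     exists psi : phpp K F, has_property S X psi) /\
  (exists (d : measure_display) (T : measurableType d) (P : probability T R)
     (K : nat) (F : R -> set (set T)) (S : R -> T -> R) (X : nat -> T -> R),
     (filtration K F /\ finite_set (F K%:R)) /\
     (adapted K F S /\ strictly_positive K S) /\
     (consumption_process K F X /\ regular K S X) /\
     ~ exists psi : phpp K F, has_property S X psi).
Proof.
split; last exact: regular_without_phpp.
move=> d T P K F S X FF finF SF _ XF Xreg X_lt XK_gt0.
(* The strict lower bounds before time [K] and at time [K] combine into positivity of every
   denominator [X k.+1] in [rep_map]. *)
have X_gt0 k : (k <= K)%N -> forall w, 0 < X k w.
  rewrite leq_eqVlt => /orP[/eqP-> //|kK w].
  by have /andP[] := X_lt k kK w.
by exists (rep_phpp FF finF SF XF Xreg X_gt0); exact: rep_phpp_property.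
Qed.
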